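(* Let $k,n,r$ be positive integers with $k\ge 2$, $n\ge 4$ and $r\le n-2$. Then $$R\Big(n,\frac{n(n-1)}2-r;k,1\Big)=\begin{cases}\max\{n,\;k+r\} & \text{if } r\le \frac n2-1,\\ \max\Big\{n,\;2k-2+\Big\lfloor\frac{2r+4-n}3\Big\rfloor\Big\} & \text{if } r>\frac n2-1.\end{cases}$$
   Context: All graphs are finite and simple. For positive integers $n,r,k,s$ with $n,k\ge 2$, the generalized Ramsey number $R(n,r;k,s)$ is the smallest positive integer $p$ such that for every graph $G$ of order $p$ (i.e. with $p$ vertices), either $G$ contains a subgraph induced by $n$ vertices with at most $r-1$ edges, or the complement $\overline G$ of $G$ contains a subgraph induced by $k$ vertices with at most $s-1$ edges. $\lfloor x\rfloor$ is the greatest integer not exceeding $x$. *)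

(* Defs.v *)
From mathcomp Require Import all_boot.

Set Implicit Arguments.
Unset Strict Implicit.
Unset Printing Implicit Defensive.

Record sgraph (V : finType) := SGraph {
  adj :> rel V;
  adj_sym : symmetric adj;
  adj_irr : irreflexive adj }.

Section Graphs.
Variables (V : finType) (G : sgraph V).

Definition compl_adj : rel V := [rel x y | (x != y) && ~~ adj G x y].

Lemma compl_sym : symmetric compl_adj.
Proof. by move=> x y; rewrite /compl_adj /= eq_sym adj_sym. Qed.

Lemma compl_irr : irreflexive compl_adj.
Proof. by move=> x; rewrite /compl_adj /= eqxx. Qed.

Definition compl : sgraph V := SGraph compl_sym compl_irr.

(* Edges are unordered pairs, so each one is counted once. *)
Definition edges : {set {set V}} :=
  [set [set x; y] | x in [set: V], y in [set z | adj G x z]].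

Definition induced_edges (S : {set V}) : {set {set V}} :=
  [set e in edges | e \subset S].

Definition has_sparse (n m : nat) : Prop :=
  exists S : {set V}, #|S| = n /\ #|induced_edges S| <= m.

End Graphs.

(* [r - 1] and [s - 1] are truncated: meaningful for positive [r] and [s]. *)
Definition ramsey_prop (n r k s p : nat) : Prop :=
  forall (V : finType) (G : sgraph V), #|V| = p ->
    has_sparse G n (r - 1) \/ has_sparse (compl G) k (s - 1).

(* [is_ramsey n r k s p] reads "R(n, r; k, s) exists and equals p". *)
Definition is_ramsey (n r k s p : nat) : Prop :=
  [/\ 0 < p, ramsey_prop n r k s p &
      forall q, 0 < q -> ramsey_prop n r k s q -> p <= q].

(* Main.v *)
Require Import Defs.
From mathcomp Require Import all_boot zify.

Set Implicit Arguments.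
Unset Strict Implicit.
Unset Printing Implicit Defensive.

(** Write [H] for the complement of the graph.  An [n]-set has at most
    [n(n-1)/2 - r - 1] edges in the graph exactly when it has more than [r]
    edges in [H], so the number sought is the least [p] such that every graph
    [H] on [p] vertices has an [n]-set spanning more than [r] edges or an
    independent set of size [k].

    Lower bounds: the graph [H] is a disjoint union of cliques, encoded by a
    labelling of the vertices.  It has an independent [k]-set only if [k]
    labels occur ([cluster_not_ramsey]).  One clique serves below [n];
    [r] disjoint edges and isolated vertices serve when [2r + 2 <= n]; and
    [t - 1] disjoint triangles together with disjoint edges serve otherwise,
    where [t] is the integer part of [(2r + 4 - n) / 3].  Summing degrees
    shows that [n] vertices of the last graph span at most
    [(n + 3(t - 1)) / 2], hence at most [r], edges.

    Upper bounds: suppose that every [n]-set spans at most [r] edges.  If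
    [2r + 2 <= n], then [H] has at most [r] edges in all, because [r + 1]
    edges would be covered by [n] vertices ([cover_edges]); discarding one end
    of each edge leaves an independent set ([stable_of_edges]).  In general a
    graph with [p] vertices and [e] edges has an independent set of size at
    least [(2p - e) / 3] ([stable_two_thirds]), which gives the result when
    [p = n].  For [p > n], were all degrees at least 2, then [n] vertices
    spanning at least [n - 1 > r] edges could be collected one at a time
    ([grow_dense]); so some vertex has degree at most 1.  If [p = n + 1], this
    forces [e <= r + 1] and the same bound suffices.  If [p > n + 1], deleting
    that vertex with its possible neighbour leaves at least [p - 2 >= n]
    vertices and lowers the independence number by at least 1, and induction
    applies ([stable_half]). *)

(** * Edge counts and degrees inside a set of vertices *)

Lemma set_add_ind (T : finType) (P : {set T} -> Prop) :
  P set0 -> (forall v (A : {set T}), v \notin A -> P A -> P (v |: A)) ->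
  forall A, P A.
Proof.
move=> P0 PS A; move: {2}#|A| (erefl #|A|) => m.
elim: m A => [|m IH] A Am; first by rewrite (cards0_eq Am).
have /set0Pn [v vA] : A != set0 by rewrite -card_gt0 Am.
rewrite -(setD1K vA); apply: PS; first by rewrite !inE eqxx.
by apply: IH; move: Am; rewrite (cardsD1 v) vA => -[].
Qed.

Lemma subset_of_size (T : finType) (A : {set T}) m :
  m <= #|A| -> exists2 S : {set T}, S \subset A & #|S| = m.
Proof.
elim: m => [|m IH] mA; first by exists set0; rewrite ?sub0set ?cards0.
have [S sSA Sm] := IH (ltnW mA).
have /set0Pn [v] : A :\: S != set0.
  by rewrite -card_gt0 cardsD (setIidPr sSA) subn_gt0 Sm.
rewrite inE => /andP [vS vA]; exists (v |: S).
  by rewrite subUset sub1set vA.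
by rewrite cardsU1 vS Sm.
Qed.

Lemma superset_of_size (T : finType) (A : {set T}) m :
  #|A| <= m <= #|T| -> exists2 S : {set T}, A \subset S & #|S| = m.
Proof.
case/andP=> Am mT.
have cA := cardsC A.
have [|S sS cS] := @subset_of_size _ (~: A) (m - #|A|); first by lia.
exists (A :|: S); first exact: subsetUl.
rewrite cardsU (_ : A :&: S = set0) ?cards0; first by lia.
apply/setP=> x; rewrite !inE; apply/negP=> /andP [xA xS].
by move/subsetP: sS => /(_ x xS); rewrite inE xA.
Qed.

Section Counting.
Variables (V : finType) (H : sgraph V).
Implicit Types (A B S I : {set V}) (v x y : V).

Definition edge_count S := #|induced_edges H S|.

Definition deg_in A v := #|[set u in A | H v u]|.

Definition stable I := forall x y, x \in I -> y \in I -> ~~ H x y.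

Lemma induced_edgesP S e :
  reflect (exists x y, [/\ H x y, x \in S, y \in S & e = [set x; y]])
          (e \in induced_edges H S).
Proof.
rewrite inE; apply: (iffP andP) => [[/imset2P [x y _]]|[x [y [xy xS yS ->]]]].
  rewrite inE => xy -> /subsetP s; exists x, y.
  by split=> //; apply: s; rewrite !inE eqxx ?orbT.
split; last by apply/subsetP => z; rewrite !inE => /orP [] /eqP ->.
by apply/imset2P; exists x y; rewrite ?inE.
Qed.

Lemma edge_countS A B : A \subset B -> edge_count A <= edge_count B.
Proof.
move=> /subsetP sAB; apply/subset_leq_card/subsetP => e.
case/induced_edgesP=> x [y [xy /sAB xB /sAB yB ->]].
by apply/induced_edgesP; exists x, y.
Qed.

Lemma edge_count0 : edge_count set0 = 0.
Proof.
apply: eq_card0 => e; apply/negP => /induced_edgesP [x [y [_]]].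
by rewrite inE.
Qed.

Lemma edge_countU1 v A :
  v \notin A -> edge_count (v |: A) = edge_count A + deg_in A v.
Proof.
move=> vA; pose N := [set u in A | H v u].
have neq u : u \in N -> u != v.
  by rewrite inE => /andP [uA _]; apply: contraNneq vA => <-.
have inj : {in N &, injective (fun u => [set v; u])}.
  move=> u w /neq uv /neq wv /setP /(_ u).
  by rewrite !inE eqxx orbT (negbTE uv) => /esym /eqP.
rewrite /deg_in -/N -(card_in_imset inj) /edge_count.
have -> : induced_edges H (v |: A)
   = induced_edges H A :|: [set [set v; u] | u in N].
  apply/setP=> e; rewrite [RHS]inE; apply/induced_edgesP/orP.
    case=> x [y [xy /setU1P [xv|xA] /setU1P [yv|yA] ->]].
    - by move: xy; rewrite xv yv adj_irr.
    - by right; apply/imsetP; exists y; rewrite ?inE ?yA -?xv.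
    - right; apply/imsetP; exists x; rewrite ?inE ?xA -?yv 1?adj_sym //.
      by rewrite setUC.
    - by left; apply/induced_edgesP; exists x, y.
  case=> [/induced_edgesP [x [y [xy xA yA ->]]]|/imsetP [u]].
    by exists x, y; rewrite !inE xA yA !orbT.
  by rewrite inE => /andP [uA vu] ->; exists v, u; rewrite !inE eqxx uA orbT.
rewrite cardsU (_ : _ :&: _ = set0) ?cards0 ?subn0 //.
apply/setP=> e; rewrite [LHS]inE [RHS]inE; apply/negP => /andP [].
case/induced_edgesP => x [y [_ xA yA ->]] /imsetP [u _ /setP /(_ v)].
rewrite !inE eqxx /= => /orP [] /eqP vE.
  by rewrite vE xA in vA.
by rewrite vE yA in vA.
Qed.

Lemma deg_in_D1 A v : deg_in (A :\ v) v = deg_in A v.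
Proof.
apply: eq_card => u; rewrite !inE.
by case: eqP => [->|]; rewrite ?adj_irr ?andbF.
Qed.

Lemma edge_countD1 v A :
  v \in A -> edge_count A = edge_count (A :\ v) + deg_in A v.
Proof.
by move=> vA; rewrite -{1}(setD1K vA) edge_countU1 ?deg_in_D1 // !inE eqxx.
Qed.

Lemma deg_inU1 v x A : v \notin A -> deg_in (v |: A) x = H x v + deg_in A x.
Proof.
move=> vA; rewrite /deg_in (cardsD1 v) !inE eqxx /=; congr (_ + _).
apply: eq_card => u; rewrite !inE.
by case: eqP => // ->; rewrite (negbTE vA).
Qed.

Lemma handshake S : \sum_(v in S) deg_in S v = 2 * edge_count S.
Proof.
elim/set_add_ind: S => [|v A vA IH]; first by rewrite big_set0 edge_count0.
rewrite big_setU1 //= (eq_bigr (fun x => H x v + deg_in A x)); last first.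
  by move=> x _; rewrite deg_inU1.
rewrite big_split /= IH edge_countU1 // deg_inU1 // adj_irr.
have -> : \sum_(x in A) (H x v : nat) = deg_in A v.
  rewrite /deg_in -sum1_card big_mkcond [RHS]big_mkcond /=.
  by apply: eq_bigr => x _; rewrite inE adj_sym; case: (x \in A); case: (H v x).
lia.
Qed.

Lemma stable_edge_count I : stable I <-> edge_count I = 0.
Proof.
split=> [sI|/eqP].
  apply: eq_card0 => e; apply/negP => /induced_edgesP [x [y [xy xI yI _]]].
  by have := sI x y xI yI; rewrite xy.
rewrite cards_eq0 => /eqP E x y xI yI; apply/negP => xy.
suff : [set x; y] \in induced_edges H I by rewrite E inE.
by apply/induced_edgesP; exists x, y.
Qed.

Lemma stable_sub I S : S \subset I -> stable I -> stable S.
Proof. by move=> /subsetP s sI x y /s xI /s; apply: sI. Qed.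

(** * Independent sets in graphs with few edges *)

(** Deleting a vertex that is not isolated destroys an edge and one vertex. *)
Lemma stable_of_edges A :
  exists I, [/\ I \subset A, stable I & #|A| <= #|I| + edge_count A].
Proof.
move: {2}#|A| (leqnn #|A|) => m; elim: m A => [|m IH] A Am.
  exists set0; split; rewrite ?sub0set //; last by lia.
  by move=> x y; rewrite inE.
have [/existsP [v /andP [vA dv]]|/existsPn Z] :=
  boolP [exists v, (v \in A) && (0 < deg_in A v)].
  have cA := cardsD1 v A; rewrite vA in cA.
  have [|I [sI stI cI]] := IH (A :\ v); first by lia.
  exists I; split=> //; first exact: subset_trans sI (subsetDl _ _).
  by rewrite (edge_countD1 vA); lia.
exists A; split=> //; last by lia.
move=> x y xA yA; apply/negP=> xy.
have := Z x; rewrite xA => /negP; apply.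
by apply/card_gt0P; exists y; rewrite inE yA.
Qed.

(** The common step of the inductions below: a vertex with at most one
    neighbour may be put into an independent set at the cost of at most two
    vertices. *)
Lemma stable_add_leaf A v :
  v \in A -> deg_in A v <= 1 ->
  exists B, [/\ B \subset A, #|A| <= #|B| + 1 + deg_in A v, #|B| < #|A|,
    edge_count B + deg_in A v <= edge_count A &
    forall I, I \subset B -> stable I ->
      [/\ v |: I \subset A, stable (v |: I) & #|v |: I| = #|I|.+1]].
Proof.
move=> vA dv; pose N := [set u in A | H v u]; pose B := (A :\ v) :\: N.
have sBA : B \subset A by rewrite !subDset setUA subsetUr.
have vB : v \notin B by rewrite !inE eqxx andbF.
exists B; split=> //.
- have := cardsD1 v A; have := cardsD (A :\ v) N.
  have := subset_leq_card (subsetIr (A :\ v) N).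
  rewrite vA -/B /deg_in -/N; lia.
- apply: proper_card; apply/properP; split=> //; by exists v.
- rewrite (edge_countD1 vA) leq_add2r; apply: edge_countS.
  exact: subsetDl.
move=> I sIB stI.
have nvI u : u \in I -> ~~ H v u.
  move=> /(subsetP sIB); rewrite !inE => /andP [+ /andP [_ uA]].
  by rewrite uA.
split.
- by rewrite subUset sub1set vA (subset_trans sIB sBA).
- move=> x y /setU1P [->|xI] /setU1P [->|yI]; rewrite ?adj_irr ?nvI //.
    by rewrite adj_sym nvI.
  exact: stI.
rewrite cardsU1; case: (boolP (v \in I)) => // /(subsetP sIB).
by rewrite (negbTE vB).
Qed.

(** Equality holds for disjoint edges and triangles.  A vertex of degree at
    least 2 may be deleted outright, since this destroys two edges; without
    such vertices a vertex and its possible neighbour are deleted. *)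
Lemma stable_two_thirds A :
  exists I, [/\ I \subset A, stable I & 2 * #|A| <= 3 * #|I| + edge_count A].
Proof.
move: {2}#|A| (leqnn #|A|) => m; elim: m A => [|m IH] A Am.
  exists set0; split; rewrite ?sub0set //; last by lia.
  by move=> x y; rewrite inE.
have [/existsP [v /andP [vA dv]]|/existsPn Z] :=
  boolP [exists v, (v \in A) && (1 < deg_in A v)].
  have cA := cardsD1 v A; rewrite vA in cA.
  have [|I [sI stI cI]] := IH (A :\ v); first by lia.
  exists I; split=> //; first exact: subset_trans sI (subsetDl _ _).
  by rewrite (edge_countD1 vA); lia.
have [A0|/set0Pn [v vA]] := eqVneq A set0.
  by apply: IH; rewrite A0 cards0.
have dv : deg_in A v <= 1 by have := Z v; rewrite vA -leqNgt.
have [B [sBA cB ltB eB addB]] := stable_add_leaf vA dv.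
have [|I [sI stI cI]] := IH B; first by lia.
have [s st c] := addB I sI stI; exists (v |: I); split=> //.
by rewrite c; lia.
Qed.

(** * Sets of prescribed size spanning many edges *)

(** A set grows by a vertex adjacent to it as long as there is one, and each
    such vertex brings an edge.  When there is none, the set is a union of
    components, in which the degree sum provides as many edges as vertices,
    so that a vertex bringing no edge can be afforded. *)
Lemma grow_dense A m :
  (forall v, v \in A -> 2 <= deg_in A v) -> m <= #|A| ->
  exists S, [/\ S \subset A, #|S| = m & m <= (edge_count S).+1].
Proof.
move=> dA; elim: m => [|m IH] mA.
  by exists set0; rewrite sub0set cards0.
have [S [sSA Sm eS]] := IH (ltnW mA).
have [/existsP [x /and3P [xA xS dx]]|/existsPn Z] :=
  boolP [exists x, [&& x \in A, x \notin S & 0 < deg_in S x]].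
  exists (x |: S); split; first by rewrite subUset sub1set xA.
    by rewrite cardsU1 xS Sm.
  by rewrite edge_countU1 //; lia.
have /set0Pn [x] : A :\: S != set0.
  by rewrite -card_gt0 cardsD (setIidPr sSA) subn_gt0 Sm.
rewrite inE => /andP [xS xA]; exists (x |: S); split.
- by rewrite subUset sub1set xA.
- by rewrite cardsU1 xS Sm.
suff : 2 * #|S| <= 2 * edge_count S by rewrite edge_countU1 // Sm; lia.
rewrite -handshake mulnC -sum_nat_const; apply: leq_sum => v vS.
apply: leq_trans (dA v (subsetP sSA v vS)) _.
apply/subset_leq_card/subsetP => u; rewrite !inE => /andP [uA vu].
rewrite vu andbT; apply: contraT => uS.
have := Z u; rewrite uA uS -leqNgt leqn0 cards_eq0 => /eqP /setP /(_ v).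
by rewrite !inE vS adj_sym vu.
Qed.

(** Each edge is a set of two vertices, so the union of [m] edges is small. *)
Lemma cover_edges m :
  m <= edge_count setT ->
  exists2 S : {set V}, #|S| <= 2 * m & m <= edge_count S.
Proof.
case/subset_of_size => F sF cF; exists (cover F).
  rewrite mulnC -cF; apply: leq_trans (leq_card_cover F) _.
  rewrite -sum_nat_const; apply: leq_sum => e /(subsetP sF).
  by case/induced_edgesP=> x [y [_ _ _ ->]]; rewrite cards2; case: eqP.
rewrite -cF; apply/subset_leq_card/subsetP => e eF.
have := subsetP sF e eF; rewrite !inE => /andP [-> _] /=.
exact: bigcup_sup.
Qed.

(** * Independent sets when every set of given size spans few edges *)

Section Sparse.
Variables (n r : nat).
Hypothesis sparse : forall S : {set V}, #|S| = n -> edge_count S <= r.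

Lemma stable_few_edges :
  2 * r + 2 <= n -> n <= #|V| ->
  exists2 I : {set V}, stable I & #|V| <= #|I| + r.
Proof.
move=> nr nV; have eV : edge_count setT <= r.
  rewrite leqNgt; apply/negP => /cover_edges [S cS eS].
  have [|S' sS cS'] := @superset_of_size _ S n; first by lia.
  by have := sparse cS'; have := edge_countS sS; lia.
have [I [_ stI cI]] := stable_of_edges setT.
by exists I => //; rewrite cardsT in cI; lia.
Qed.

Lemma exists_leaf A :
  r + 2 <= n -> n <= #|A| -> exists2 v, v \in A & deg_in A v <= 1.
Proof.
move=> rn nA.
have [/existsP [v /andP [vA dv]]|/existsPn Z] :=
  boolP [exists v, (v \in A) && (deg_in A v <= 1)]; first by exists v.
have [|S [_ /sparse eS nS]] := grow_dense _ nA; last by lia.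
by move=> v vA; have := Z v; rewrite vA -ltnNge.
Qed.

(** Deleting a vertex of degree at most 1 with its neighbour may overshoot
    [n] when [#|A| = n + 1]; in that case [A] still has at most [r + 1]
    edges, because deleting that vertex alone leaves [n] vertices. *)
Lemma stable_half A :
  r + 2 <= n -> n <= #|A| ->
  exists2 I, stable I & #|A| + 1 <= 2 * #|I| + (2 * r + 4 - n) %/ 3.
Proof.
move=> rn; suff main : n <= #|A| -> exists I, [/\ I \subset A, stable I &
    #|A| + 1 <= 2 * #|I| + (2 * r + 4 - n) %/ 3].
  by move=> /main [I [_ stI cI]]; exists I.
move: {2}#|A| (leqnn #|A|) => m; elim: m A => [|m IH] A Am nA; first by lia.
have [An|An] := eqVneq #|A| n.
  have [I [sI stI cI]] := stable_two_thirds A; exists I; split=> //.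
  by have := sparse An; lia.
have [v vA dv] := exists_leaf rn nA.
have [An1|An1] := eqVneq #|A| n.+1.
  have [I [sI stI cI]] := stable_two_thirds A; exists I; split=> //.
  have cA := cardsD1 v A; rewrite vA An1 in cA.
  have /sparse : #|A :\ v| = n by lia.
  by have := edge_countD1 vA; lia.
have [B [sBA cB ltB _ addB]] := stable_add_leaf vA dv.
have [||I [sI stI cI]] := IH B; [by lia|by lia|].
have [s st c] := addB I sI stI; exists (v |: I); split=> //.
by rewrite c; lia.
Qed.

End Sparse.
End Counting.

(** * Passing to the complement *)

Lemma edge_count_compl (V : finType) (G : sgraph V) (S : {set V}) :
  edge_count G S + edge_count (compl G) S = 'C(#|S|, 2).
Proof.
elim/set_add_ind: S => [|v A vA IH]; first by rewrite !edge_count0 cards0.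
rewrite !edge_countU1 // cardsU1 vA binS bin1 -IH.
suff -> : #|A| = deg_in G A v + deg_in (compl G) A v by lia.
rewrite -(cardsID [set u | G v u] A) /deg_in.
congr (_ + _); apply: eq_card => u; rewrite !inE //.
rewrite /= /compl_adj /= andbC.
by case: (eqVneq v u) => [<-|_] //=; rewrite (negbTE vA).
Qed.

Lemma compl_has_sparse (V : finType) (G : sgraph V) n r :
  r + 2 <= n ->
  has_sparse G n ((n * (n - 1)) %/ 2 - r - 1) <->
  exists2 S : {set V}, #|S| = n & r < edge_count (compl G) S.
Proof.
move=> rn.
have bn : 'C(n, 2) = (n * (n - 1)) %/ 2 by rewrite bin2 divn2 subn1.
have rb : r < 'C(n, 2).
  rewrite bn leq_divRL //; have := leq_mul rn (leqnn (n - 1)); nia.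
rewrite -bn; split=> [[S [cS]]|[S cS]].
  rewrite -/(edge_count G S); have := edge_count_compl G S; rewrite cS => E L.
  by exists S => //; lia.
have := edge_count_compl G S; rewrite cS => E L.
by exists S; split=> //; rewrite -/(edge_count G S); lia.
Qed.

Lemma has_sparse_stable (V : finType) (G : sgraph V) k :
  has_sparse G k 0 <-> exists2 S : {set V}, #|S| = k & stable G S.
Proof.
split=> [[S [cS]]|[S cS stS]].
  by rewrite leqn0 => /eqP /stable_edge_count; exists S.
exists S; split=> //; rewrite -/(edge_count G S).
by move/stable_edge_count: stS => ->.
Qed.

Lemma ramsey_of_stable n r k p :
  r + 2 <= n ->
  (forall (V : finType) (H : sgraph V), #|V| = p ->
     (forall S : {set _}, #|S| = n -> edge_count H S <= r) ->
     exists2 I : {set V}, stable H I & k <= #|I|) ->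
  ramsey_prop n ((n * (n - 1)) %/ 2 - r) k 1 p.
Proof.
move=> rn P V G Vp.
have [/existsP [S /andP [/eqP cS eS]]|/existsPn Z] := boolP
  [exists S : {set V}, (#|S| == n) && (r < edge_count (compl G) S)].
  by left; apply/(compl_has_sparse _ rn); exists S.
right; rewrite subnn; apply/has_sparse_stable.
have [|I stI kI] := P V (compl G) Vp.
  by move=> S cS; have := Z S; rewrite cS eqxx -leqNgt.
have [S sS cS] := subset_of_size kI; exists S => //.
exact: stable_sub stI.
Qed.

(** * Disjoint unions of cliques *)

Section Cluster.
Variables (q : nat) (f : 'I_q -> nat).

Lemma multipartite_sym : symmetric [rel x y | f x != f y].
Proof. by move=> x y /=; rewrite eq_sym. Qed.

Lemma multipartite_irr : irreflexive [rel x y | f x != f y].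
Proof. by move=> x /=; rewrite eqxx. Qed.

(** The cliques are encoded through the complete multipartite graph so that
    the counterexample is literally of the form [compl G]. *)
Definition multipartite := SGraph multipartite_sym multipartite_irr.

Definition cluster := compl multipartite.

Lemma clusterE x y : cluster x y = (x != y) && (f x == f y).
Proof. by rewrite /= /compl_adj /= negbK. Qed.

Lemma cluster_not_ramsey n r k :
  r + 2 <= n -> 2 <= k -> (forall x, f x < k - 1) ->
  (forall S : {set _}, #|S| = n -> edge_count cluster S <= r) ->
  ~ ramsey_prop n ((n * (n - 1)) %/ 2 - r) k 1 q.
Proof.
move=> rn k2 fk sp /(_ _ multipartite (card_ord q)) [].
  by case/(compl_has_sparse _ rn) => S /sp; rewrite leqNgt => /negP.
rewrite subnn => /has_sparse_stable [S cS stS].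
pose g x : 'I_(k - 1) := Ordinal (fk x).
have inj : {in S &, injective g}.
  move=> x y xS yS [] fxy; have := stS x y xS yS.
  by rewrite -/cluster clusterE fxy eqxx andbT negbK => /eqP.
by have := max_card (g @: S); rewrite card_in_imset // cS card_ord; lia.
Qed.

Lemma card_ord_interval a m : #|[set u : 'I_q | a <= u < a + m]| <= m.
Proof.
case: m => [|m].
  by rewrite leqn0 cards_eq0; apply/eqP/setP => u; rewrite !inE; lia.
pose g (u : 'I_q) : 'I_m.+1 := inord (u - a).
have inj : {in [set u : 'I_q | a <= u < a + m.+1] &, injective g}.
  move=> u w; rewrite !inE => hu hw /(congr1 val).
  rewrite /= !inordK; [|lia|lia] => E; apply: val_inj => /=; lia.
by rewrite -(card_in_imset inj) -[X in _ <= X]card_ord max_card.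
Qed.

Lemma card_ord_lt (S : {set 'I_q}) m : #|[set u in S | (u : nat) < m]| <= m.
Proof.
apply: leq_trans (card_ord_interval 0 m); apply/subset_leq_card/subsetP => u.
by rewrite !inE => /andP [].
Qed.

(** A clique inside an interval of [m + 1] vertices gives its members at most
    [m] neighbours, the vertex itself being excluded. *)
Lemma deg_cluster (S : {set 'I_q}) x a m :
  (forall u, f u = f x -> a <= u < a + m.+1) -> deg_in cluster S x <= m.
Proof.
move=> fib; rewrite -ltnS; apply: leq_trans (card_ord_interval a m.+1).
rewrite [X in _ < X](cardsD1 x) inE (fib x erefl) ltnS.
apply/subset_leq_card/subsetP => u; rewrite [u \in _]inE clusterE.
case/and3P=> _ xu /eqP fu; rewrite !inE eq_sym xu; exact: fib.
Qed.

Lemma cluster_edges_le (S : {set 'I_q}) m c d :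
  (forall x, deg_in cluster S x <= d + c * (x < m)) ->
  2 * edge_count cluster S <= d * #|S| + c * m.
Proof.
move=> dS; rewrite -handshake.
have le : \sum_(x in S) deg_in cluster S x <= \sum_(x in S) (d + c * (x < m)).
  by apply: leq_sum => x _; exact: dS.
apply: leq_trans le _.
rewrite big_split /= sum_nat_const -big_distrr /= mulnC leq_add2l leq_mul2l.
apply/orP; right; apply: leq_trans (card_ord_lt S m).
rewrite -sum1_card big_mkcond [X in _ <= X]big_mkcond /=.
by apply: leq_sum => x _; rewrite inE; case: (x \in S).
Qed.

End Cluster.

Lemma clique_not_ramsey n r k q :
  r + 2 <= n -> 2 <= k -> q < n ->
  ~ ramsey_prop n ((n * (n - 1)) %/ 2 - r) k 1 q.
Proof.
move=> rn k2 qn; apply: (@cluster_not_ramsey _ (fun=> 0)) => //.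
  by move=> _; lia.
by move=> S cS; have := max_card S; rewrite card_ord cS; lia.
Qed.

Lemma matching_not_ramsey n r k q :
  r + 2 <= n -> 2 <= k -> 2 * r <= q -> q < k + r ->
  ~ ramsey_prop n ((n * (n - 1)) %/ 2 - r) k 1 q.
Proof.
move=> rn k2 rq qk.
pose f (x : 'I_q) := if x < 2 * r then x %/ 2 else x - r.
apply: (@cluster_not_ramsey _ f) => //.
  by move=> x; have := ltn_ord x; rewrite /f; case: ifP; lia.
move=> S cS.
suff : 2 * edge_count (cluster f) S <= 0 * #|S| + 1 * (2 * r) by lia.
apply: cluster_edges_le => x; case: (ltnP x (2 * r)) => xr.
  apply: (@deg_cluster _ _ _ _ (x %/ 2 * 2)) => u.
  by rewrite /f xr; case: ifP; lia.
apply: (@deg_cluster _ _ _ _ x) => u.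
by rewrite /f [x < _]ltnNge xr /=; case: ifP; lia.
Qed.

(** The graph has [c] triangles and the remaining vertices are paired.  The
    degree sum over [n] vertices is then at most [n + 3c], one for each vertex
    and one more for each of the [3c] vertices in triangles; the bound by
    [2r + 1] therefore keeps the number of edges at most [r]. *)
Lemma triangles_not_ramsey n r k c q :
  r + 2 <= n -> 2 <= k -> c < k -> n + 3 * c <= 2 * r + 1 ->
  q <= 2 * (k - 1) + c ->
  ~ ramsey_prop n ((n * (n - 1)) %/ 2 - r) k 1 q.
Proof.
move=> rn k2 ck nc qk.
pose f (x : 'I_q) :=
  if x < 3 * c then x %/ 3 else c + (x - 3 * c) %/ 2.
apply: (@cluster_not_ramsey _ f) => //.
  by move=> x; have := ltn_ord x; rewrite /f; case: ifP; lia.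
move=> S cS.
suff : 2 * edge_count (cluster f) S <= 1 * #|S| + 1 * (3 * c) by lia.
apply: cluster_edges_le => x; case: (ltnP x (3 * c)) => xr.
  apply: (@deg_cluster _ _ _ _ (x %/ 3 * 3)) => u.
  by rewrite /f xr; case: ifP; lia.
apply: (@deg_cluster _ _ _ _ (3 * c + (x - 3 * c) %/ 2 * 2)) => u.
by rewrite /f [x < _]ltnNge xr /=; case: ifP; lia.
Qed.

(* The test r <= n/2 - 1 is over the rationals, hence 2 * r + 2 <= n.  In the
   other case n < 2 * r + 2, so the subtraction 2 * r + 4 - n is exact. *)
Theorem theorem4p1 (k n r : nat) (hk : 2 <= k) (hn : 4 <= n)
    (hr0 : 0 < r) (hr : r <= n - 2) :
  is_ramsey n ((n * (n - 1)) %/ 2 - r) k 1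
    (if 2 * r + 2 <= n then maxn n (k + r)
     else maxn n (2 * k - 2 + (2 * r + 4 - n) %/ 3)).
Proof.
have rn : r + 2 <= n by lia.
case: leqP => nr; split; try by lia.
- apply: ramsey_of_stable => // V H Vp sp.
  have [|I stI cI] := stable_few_edges sp nr; first by lia.
  by exists I => //; lia.
- move=> q _ hq; rewrite leqNgt; apply/negP => lt.
  have [qn|nq] := ltnP q n; first exact: clique_not_ramsey hq.
  by apply: matching_not_ramsey hq => //; lia.
- apply: ramsey_of_stable => // V H Vp sp.
  have [|I stI] := stable_half sp (A := setT) rn; rewrite cardsT; first by lia.
  by move=> cI; exists I => //; lia.
move=> q _ hq; rewrite leqNgt; apply/negP => lt.
have [qn|nq] := ltnP q n; first exact: clique_not_ramsey hq.
by apply: (@triangles_not_ramsey _ _ _ ((2 * r + 4 - n) %/ 3 - 1)) hq; lia.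
Qed.
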